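(* Let $\mathbb{P}$ be a multiplicative subsemigroup of $\mathbb{N}=\{1,2,3,\dots\}$ with $\mathbb{P}\not\subseteq\{1\}$. Then every simple $\mathbb{P}$-torsion-free partially ordered abelian group $A$ embeds cofinally into a simple $\mathbb{P}$-torsion-free Riesz group $B$ with quasi-divisible positive cone such that, in addition, $B/A$ is torsion-free.
   Context: A partially ordered abelian group is an abelian group $G$ with a translation-invariant partial order; its positive cone is $G^+=\{x\in G: x\ge 0\}$. It is directed if every element is a difference of two elements of $G^+$. $G$ is simple if it is directed and every nonzero $u\in G^+$ is an order-unit (every $x\in G$ satisfies $x\le nu$ for some positive integer $n$). $G$ is $\mathbb{P}$-torsion-free if for all $p\in\mathbb{P}$, $px=py\Rightarrow x=y$. An embedding $f:A\to B$ of partially ordered abelian groups is an injective group homomorphism such that $x\ge0\iff f(x)\ge0$; it is cofinal if every $b\in B$ satisfies $b\le f(a)$ for some $a\in A$; $A$ is identified with its image when writing $B/A$. A Riesz group is a directed partially ordered abelian group with the interpolation property: whenever $x_0,x_1\le y_0,y_1$ there is $z$ with $x_0,x_1\le z\le y_0,y_1$. A commutative monoid (such as $B^+$) is quasi-divisible if for every element $x$ of it there are elements $u,v$ of it with $2u+3v=x$. *)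

(* Defs.v *)
From HB Require Import structures.
From mathcomp Require Import all_boot all_order all_algebra.
From mathcomp Require Import boolp classical_sets.

Set Implicit Arguments.
Unset Strict Implicit.
Unset Printing Implicit Defensive.

Import Order.TTheory GRing.Theory.

Local Open Scope classical_set_scope.
Local Open Scope ring_scope.

(* [porderZmodType] does not relate the order to the addition. *)
HB.mixin Record isTranslationInvariant G of Num.POrderedZmodule G := {
  lepoD2r : forall z x y : G, x <= y -> x + z <= y + z
}.

#[short(type="poAbGroupType")]
HB.structure Definition POAbGroup :=
  { G of Num.POrderedZmodule G & isTranslationInvariant G }.

Definition positive_cone (G : porderZmodType) : set G := [set x | 0 <= x].

Definition directed_group (G : porderZmodType) : Prop :=
  forall x : G, exists y z : G,
    [/\ positive_cone y, positive_cone z & x = y - z].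

Definition order_unit (G : porderZmodType) (u : G) : Prop :=
  positive_cone u /\
  forall x : G, exists n : nat, (0 < n)%N /\ x <= u *+ n.

Definition simple_group (G : porderZmodType) : Prop :=
  directed_group G /\
  forall u : G, positive_cone u -> u <> 0 -> order_unit u.

Definition interpolation (G : porderZmodType) : Prop :=
  forall x0 x1 y0 y1 : G,
    x0 <= y0 -> x0 <= y1 -> x1 <= y0 -> x1 <= y1 ->
    exists z : G, [/\ x0 <= z, x1 <= z, z <= y0 & z <= y1].

Definition riesz_group (G : porderZmodType) : Prop :=
  directed_group G /\ interpolation G.

Definition mul_subsemigroup (P : set nat) : Prop :=
  (forall p, P p -> (0 < p)%N) /\
  (forall p q, P p -> P q -> P (p * q)%N).

Definition torsion_free_wrt (P : set nat) (G : zmodType) : Prop :=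
  forall p, P p -> forall x y : G, x *+ p = y *+ p -> x = y.

Definition torsion_free (G : zmodType) : Prop :=
  torsion_free_wrt [set n | (0 < n)%N] G.

(* M is meant to be a submonoid of V, viewed as a monoid in its own right. *)
Definition quasi_divisible (V : nmodType) (M : set V) : Prop :=
  forall x, M x -> exists u v, [/\ M u, M v & u *+ 2 + v *+ 3 = x].

Definition po_embedding (A B : porderZmodType) (f : {additive A -> B}) : Prop :=
  injective f /\ forall x : A, 0 <= x <-> 0 <= f x.

Definition cofinal_map (A B : porderZmodType) (f : A -> B) : Prop :=
  forall b : B, exists a : A, b <= f a.

Section Cokernel.
Variables (A B : zmodType) (f : {additive A -> B}).

Definition image_pred : {pred B} := fun b => `[< range f b >].

Lemma image_pred_closed : zmod_closed image_pred.
Proof.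
split; first by apply/asboolP; exists 0 => //; rewrite raddf0.
move=> _ _ /asboolP[x _ <-] /asboolP[y _ <-].
by apply/asboolP; exists (x - y) => //; rewrite raddfB.
Qed.

HB.instance Definition _ := GRing.isZmodClosed.Build B image_pred
  image_pred_closed.

(* B / f(A); the quotient construction needs a boolean predicate. *)
Definition coker : zmodType := Quotient.quot (image_pred : zmodClosed B).

End Cokernel.

(* Main.v *)
Require Import Defs.
From HB Require Import structures.
From mathcomp Require Import all_boot all_order all_algebra.
From mathcomp Require Import boolp classical_sets functions zify.

(* B is the difference group of a pointed cone C inside A x Z^N, where N is a
   set of formal names.  Adjoin one free generator z to a simple group and ask
   it to solve a problem: either x_i <= z <= y_j, where x_i < y_j, or
   2z <= x <= 3z (so that x = 2(3z - x) + 3(x - 2z)).  Every combination of the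
   new positive elements in which z cancels is a sum of many elements of a
   fixed finite set of positive elements: the y_j - x_i, or x alone.  Since the
   group is simple, sufficiently long sums of that kind exceed any given u, so
   the new elements can be forced to dominate a fixed fraction of u without
   creating new positive elements in the old group; the enlarged group is then
   simple again.  Zorn's lemma yields a cone in which all problems are solved.
   Giving each problem its own coordinate guarantees that the generator needed
   for an unsolved problem is still available, and the quotient by A is a
   subgroup of Z^N, hence torsion-free. *)

Local Open Scope classical_set_scope.

Set Implicit Arguments.
Unset Strict Implicit.
Unset Printing Implicit Defensive.

Import Order.TTheory GRing.Theory.
Local Open Scope ring_scope.

(** * Deciding identities in abelian groups *)

Inductive zmod_expr :=
  | ZAtom of nat | ZZero | ZAdd of zmod_expr & zmod_expr
  | ZOpp of zmod_expr | ZMuln of zmod_expr & nat.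

Fixpoint zmod_eval (U : zmodType) (env : seq U) e : U :=
  match e with
  | ZAtom i => env`_i
  | ZZero => 0
  | ZAdd a b => zmod_eval env a + zmod_eval env b
  | ZOpp a => - zmod_eval env a
  | ZMuln a n => zmod_eval env a *+ n
  end.

Fixpoint zmod_coef e (j : nat) : int :=
  match e with
  | ZAtom i => (i == j)%:Z
  | ZZero => 0
  | ZAdd a b => zmod_coef a j + zmod_coef b j
  | ZOpp a => - zmod_coef a j
  | ZMuln a n => zmod_coef a j * n%:Z
  end.

(** Atoms beyond the end of [env] read the default 0, so the sum over [size env] loses nothing. *)
Lemma zmod_evalE (U : zmodType) (env : seq U) e :
  zmod_eval env e = \sum_(j < size env) env`_j *~ zmod_coef e j.
Proof.
elim: e => [i||a IHa b IHb|a IHa|a IHa n] /=.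
- have [lt_i|ge_i] := ltnP i (size env).
    rewrite (bigD1 (Ordinal lt_i)) //= eqxx big1 ?addr0 // => j.
    by rewrite -val_eqE eq_sym /= => /negbTE ->.
  rewrite nth_default // big1 // => j _.
  by rewrite (gtn_eqF (leq_trans (ltn_ord j) ge_i)).
- by rewrite big1.
- by rewrite IHa IHb -big_split; apply: eq_bigr => j _; rewrite mulrzDr.
- by rewrite IHa -sumrN; apply: eq_bigr => j _; rewrite mulrNz.
- by rewrite IHa -sumrMnl; apply: eq_bigr => j _; rewrite mulrzA pmulrn.
Qed.

Lemma zmod_eq (U : zmodType) (env : seq U) a b :
    all (fun j => zmod_coef a j == zmod_coef b j) (iota 0 (size env)) ->
  zmod_eval env a = zmod_eval env b.
Proof.
move=> /allP ab; rewrite !zmod_evalE; apply: eq_bigr => j _; congr (_ *~ _).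
by apply/eqP/ab; rewrite mem_iota ltn_ord.
Qed.

(* Atoms are compared up to conversion: the same term may come with different
   paths through the algebraic hierarchy. *)
Ltac zmod_insert x env :=
  match env with
  | nil => constr:(x :: nil)
  | ?y :: _ => let _ := constr:(erefl x : x = y) in env
  | ?y :: ?env' => let e := zmod_insert x env' in constr:(y :: e)
  end.

(** Succeeds only on closed numerals, the multipliers whose coefficients can be computed. *)
Ltac zmod_numeral n :=
  match n with O => constr:(tt) | S ?m => zmod_numeral m end.

Ltac zmod_atoms t env :=
  match t with
  | ?a + ?b => let env' := zmod_atoms a env in zmod_atoms b env'
  | - ?a => zmod_atoms a env
  | ?a *+ ?n =>
    match n with
    | S _ => let _ := zmod_numeral n in zmod_atoms a env
    | _ => zmod_insert t env
    end
  | 0 => env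
  | _ => zmod_insert t env
  end.

Ltac zmod_index x env :=
  match env with
  | ?y :: _ => let _ := constr:(erefl x : x = y) in constr:(0%N)
  | _ :: ?env' => let i := zmod_index x env' in constr:(S i)
  end.

(** Atoms are tried first, so that [a *+ n] with a variable [n], recorded as an atom, is not taken
    apart. *)
Ltac zmod_reify t env :=
  match env with
  | _ => let i := zmod_index t env in constr:(ZAtom i)
  | _ =>
  match t with
  | ?a + ?b => let a' := zmod_reify a env in let b' := zmod_reify b env in
      constr:(ZAdd a' b')
  | - ?a => let a' := zmod_reify a env in constr:(ZOpp a')
  | ?a *+ ?n => let a' := zmod_reify a env in constr:(ZMuln a' n)
  | 0 => constr:(ZZero)
  end end.

Ltac zmod :=
  match goal with |- @eq ?U ?a ?b =>
    let env := zmod_atoms a (@nil U) in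
    let env := zmod_atoms b env in
    let a' := zmod_reify a env in
    let b' := zmod_reify b env in
    exact: (@zmod_eq _ env a' b' isT)
  end.

(** * Simple cones *)

(** The positive cone of a simple group, namely of the differences of [C]; bounding elements of [C]
    suffices, since [c - d] lies below [c]. *)
Record simple_cone (U : zmodType) (C : set U) : Prop := SimpleCone {
  cone0 : C 0;
  coneD : forall x y, C x -> C y -> C (x + y);
  cone_pointed : forall x, C x -> C (- x) -> x = 0;
  cone_unit : forall u x, C u -> u <> 0 -> C x -> exists n, C (u *+ n - x)
}.

(** The second clause keeps [C'] from making new elements of the difference group of [C]
    positive. *)
Definition order_extension (U : zmodType) (C C' : set U) : Prop :=
  C `<=` C' /\ forall x y, C x -> C y -> C' (x - y) -> C (x - y).

Section SimpleConeTheory.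
Variables (U : zmodType) (C : set U).
Hypothesis hC : simple_cone C.

Definition pos (x : U) := C x /\ x <> 0.

Lemma coneMn x n : C x -> C (x *+ n).
Proof.
move=> Cx; elim: n => [|n IH]; first exact: (cone0 hC).
by rewrite mulrS; exact: (coneD hC).
Qed.

Lemma cone_sum (s : seq U) : {subset s <= C} -> C (\sum_(x <- s) x).
Proof.
move=> sC; rewrite big_seq; elim/big_ind : _ => [|x y|x /sC]; first exact: (cone0 hC).
  exact: (coneD hC).
by rewrite inE.
Qed.

Lemma posD x y : pos x -> C y -> pos (x + y).
Proof.
move=> [Cx x0] Cy; split; first exact: (coneD hC).
by move=> /addr0_eq xy; apply: x0; apply: (cone_pointed hC) => //; rewrite xy.
Qed.

(** Pigeonhole on [D]: if [d] occurs more than [n] times, where [n] copies dominate [u], the spare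
    copy gives strictness; otherwise at least [K] terms other than [d] remain for the induction
    hypothesis. *)
Lemma long_sum_pos (D : seq U) u : (forall d, d \in D -> pos d) -> C u ->
  exists2 K, (0 < K)%N & forall t : seq U, {subset t <= D} ->
    (K <= size t)%N -> pos (\sum_(x <- t) x - u).
Proof.
move=> + Cu; elim: D => [_|d D IH dD].
  exists 1%N => // -[//|x t] /(_ x); rewrite mem_head => /(_ isT).
  by rewrite in_nil.
have [K _ KP] : exists2 K, (0 < K)%N & forall t : seq U, {subset t <= D} ->
    (K <= size t)%N -> pos (\sum_(x <- t) x - u).
  by apply: IH => e eD; apply: dD; rewrite in_cons eD orbT.
have dpos : pos d by apply: dD; rewrite mem_head.
have [n Cn] := cone_unit hC dpos.1 dpos.2 Cu.
exists (K + n.+1)%N => [|t tD tK]; first by rewrite addnS.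
have -> : \sum_(x <- t) x =
    d *+ count_mem d t + \sum_(x <- [seq x <- t | x != d]) x.
  rewrite big_filter (bigID (pred1 d)) /=; congr (_ + _).
  rewrite (eq_bigr (fun=> d)); last by move=> i /eqP.
  by rewrite big_const_seq iter_addr_0.
have tD' : {subset [seq x <- t | x != d] <= D}.
  by move=> x; rewrite mem_filter => /andP[xd /tD]; rewrite in_cons (negbTE xd).
have tC : C (\sum_(x <- [seq x <- t | x != d]) x).
  apply: cone_sum => x /tD' xD; rewrite inE.
  by have [] := dD x; rewrite ?in_cons ?xD ?orbT.
have [nc|nc] := leqP n.+1 (count_mem d t).
  rewrite -(subnKC nc); set m := (_ - _)%N; set y := \sum_(_ <- _) _.
  have -> : d *+ (n.+1 + m) + y - u = d + ((d *+ n - u) + (d *+ m + y)).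
    by rewrite mulrnDr mulrS; zmod.
  by apply: posD => //; do !apply: (coneD hC) => //; apply: coneMn; case: dpos.
rewrite -addrA addrC; apply: posD; last by apply: coneMn; case: dpos.
apply: KP => //; rewrite size_filter.
have tE : size t = (count_mem d t + count (fun x => x != d) t)%N.
  exact/esym/(count_predC (pred1 d) t).
by rewrite -(leq_add2l (count_mem d t)) -tE; apply: leq_trans tK; lia.
Qed.

(** Cut [t] into [n] blocks of length [K], each exceeding [u]. For [n = 0] strictness comes from [t]
    being nonempty. *)
Lemma chunks_sum_pos (D : seq U) (u : U) : (forall d, d \in D -> pos d) -> C u ->
  exists2 K, (0 < K)%N & forall (t : seq U) n, {subset t <= D} ->
    (0 < size t)%N -> (n * K <= size t)%N -> pos (\sum_(x <- t) x - u *+ n).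
Proof.
move=> dD Cu; have [K K0 KP] := long_sum_pos dD Cu; exists K => // t n tD t0.
have tC (s : seq U) : {subset s <= D} -> {subset s <= C}.
  by move=> sD x /sD /dD []; rewrite inE.
have CP (s : seq U) m : {subset s <= D} -> (m * K <= size s)%N ->
    C (\sum_(x <- s) x - u *+ m).
  elim: m s => [|m IH] s sD ms; first by rewrite mulr0n subr0; apply/cone_sum/tC.
  rewrite -(cat_take_drop K s) big_cat /= mulrS opprD addrACA.
  apply: (coneD hC).
    apply: (KP _ _ _).1; last by rewrite size_takel //; lia.
    by move=> x /mem_take /sD.
  by apply: IH => [x /mem_drop /sD //|]; rewrite size_drop; lia.
case: n => [_|n nK].
  rewrite mulr0n subr0; case: t tD t0 => // x t tD _; rewrite big_cons.
  apply: posD; first by apply/dD/tD/mem_head.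
  by apply/cone_sum/tC => y yt; apply: tD; rewrite in_cons yt orbT.
rewrite -(cat_take_drop K t) big_cat /= mulrS opprD addrACA.
apply: posD; first apply: KP; first by move=> x /mem_take /tD.
  by rewrite size_takel //; lia.
by apply: CP => [x /mem_drop /tD //|]; rewrite size_drop; lia.
Qed.
End SimpleConeTheory.

(** * Extending a simple cone by finitely many new positive elements *)

Section OneStep.
Variables (U : zmodType) (C : set U) (pi : {additive U -> int}).
Hypotheses (hC : simple_cone C) (piC : forall c, C c -> pi c = 0).
Variables (G D : seq U) (r : nat) (u : U).
Hypotheses (u_pos : pos C u) (r_gt0 : (0 < r)%N).
Hypothesis D_pos : forall d, d \in D -> pos C d.
Hypothesis G_balanced : forall s : seq U, {subset s <= G} ->
  pi (\sum_(g <- s) g) = 0 -> exists t : seq U, [/\ {subset t <= D},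
    \sum_(g <- s) g = \sum_(d <- t) d & (size s <= r * size t)%N].
Hypothesis G_bounded : forall g, g \in G -> exists s : seq U,
  [/\ {subset s <= G}, (0 < size s)%N & C (g + \sum_(h <- s) h)].

(* The slack [n * L < size s] in the definition of F below makes every new
   positive element an order-unit. *)
Lemma one_step_extension : exists C' : set U,
  [/\ simple_cone C', order_extension C C', {subset G <= C'} &
      forall S : zmodClosed U, {subset C <= S} -> {subset G <= S} ->
      {subset C' <= S}].
Proof.
have [K K0 KP] := chunks_sum_pos hC D_pos u_pos.1.
pose L := (r * K)%N.
have L0 : (0 < L)%N by rewrite muln_gt0 r_gt0.
(* If a sum of more than [n * L] elements of [G] is balanced, rewriting it over [D] leaves at least
   [n * K] terms, so it exceeds [u *+ n]. *)
pose F e := exists c (s : seq U) n, [/\ C c, {subset s <= G},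
  (n * L < size s)%N & e = c + \sum_(g <- s) g - u *+ n].
pose C' := [set e | C e \/ F e].
(* A new positive element with [pi e = 0] was already strictly positive. Hence 0 is not in [F],
   which gives pointedness, and the old group gets no new relations. *)
have FP e : F e -> pi e = 0 -> pos C e.
  move=> [c [s [n [Cc sG nL ->]]]].
  rewrite raddfB raddfD raddfMn (piC Cc) (piC u_pos.1) mul0rn subr0 add0r => ps.
  have [t [tD -> st]] := G_balanced sG ps.
  rewrite -addrA addrC; apply: posD => //; apply: KP => //.
    by rewrite lt0n; apply: contraTneq nL => t0; move: st; rewrite t0; lia.
  by rewrite -(leq_pmul2l r_gt0); apply: leq_trans st; rewrite mulnCA ltnW.
have F0 : ~ F 0 by move=> /FP; rewrite raddf0 => /(_ erefl) [].
have FD x y : F x -> C' y -> F (x + y).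
  move=> [c [s [n [Cc sG nL ->]]]] [Cy|[c' [s' [n' [Cc' sG' nL' ->]]]]].
    by exists (c + y), s, n; split=> //; [exact: (coneD hC)|zmod].
  exists (c + c'), (s ++ s'), (n + n')%N; split.
  - exact: (coneD hC).
  - by move=> z; rewrite mem_cat => /orP[/sG|/sG'].
  - rewrite size_cat; lia.
  - rewrite big_cat mulrnDr /=.
    set a := \sum_(_ <- _) _; set b := \sum_(_ <- _) _; zmod.
have C'D x y : C' x -> C' y -> C' (x + y).
  move=> [Cx|Fx] y'; last by right; apply: FD.
  case: (y') => [Cy|Fy]; first by left; apply: (coneD hC).
  by right; rewrite addrC; apply: FD => //; left.
have C'Mn x n : C' x -> C' (x *+ n).
  move=> Cx; elim: n => [|n IH]; first by left; apply: (cone0 hC).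
  by rewrite mulrS; apply: C'D.
have Fu x : F x -> exists n, C' (x *+ n - u).
  move=> [c [s [n [Cc sG nL ->]]]].
  (* Each copy of [x] has at least one summand beyond [n * L]; [2 * L] copies collect more than the
     [L] that one further [u] costs. *)
  pose m := (2 * L)%N.
  have [s' [sG' ss' es']] : exists s' : seq U, [/\ {subset s' <= G},
      size s' = (m * size s)%N & \sum_(g <- s') g = (\sum_(g <- s) g) *+ m].
    elim: m => [|m [s' [sG' ss' es']]]; first by exists [::]; rewrite big_nil.
    exists (s ++ s'); split; last by rewrite big_cat es' mulrS.
      by move=> z; rewrite mem_cat => /orP[/sG|/sG'].
    by rewrite size_cat ss' mulSn.
  exists m; right; exists (c *+ m), s', (n * m).+1; split=> //.
  - exact: coneMn.
  - rewrite ss' /m; nia.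
  - rewrite es' mulrS mulrnA mulrnBl mulrnDl; zmod.
have GC g : g \in G -> F g.
  move=> gG; exists 0, [:: g], 0%N; split=> //; first exact: (cone0 hC).
    by move=> x; rewrite inE => /eqP ->.
  by rewrite big_seq1 mulr0n; zmod.
have uB x : C' x -> exists n, C' (u *+ n - x).
  have uC c : C c -> exists n, C' (u *+ n - c).
    by move=> /(cone_unit hC u_pos.1 u_pos.2) [n Cn]; exists n; left.
  move=> [/uC //|[c [s [n [Cc sG _ ->]]]]].
  have [k Ck] : exists k, C' (u *+ k - \sum_(g <- s) g).
    elim: s sG => [|g s IH] sG.
      by exists 0%N; rewrite big_nil mulr0n subr0; left; apply: (cone0 hC).
    have [g' g's|k Ck] := IH; first by apply: sG; rewrite in_cons g's orbT.
    (* [g] lies below the old element [g + \sum_(h <- s') h], since the nonempty sum over [s'] is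
       itself in [F]. *)
    have [s' [s'G s'0 /uC [k' Ck']]] := G_bounded (sG _ (mem_head _ _)).
    exists (k + k')%N; rewrite big_cons mulrnDr.
    set a := \sum_(_ <- _) _ in Ck *; set b := \sum_(_ <- _) _ in Ck'.
    have -> : u *+ k + u *+ k' - (g + a) =
       (u *+ k - a) + (u *+ k' - (g + b) + b) by zmod.
    apply: (C'D) => //; apply: C'D => //; right; exists 0, s', 0%N; split=> //.
      exact: (cone0 hC).
    by rewrite mulr0n; zmod.
  have [k' Ck'] := uC _ Cc.
  exists (k + k')%N; rewrite mulrnDr.
  set a := \sum_(_ <- _) _ in Ck *.
  have -> : u *+ k + u *+ k' - (c + a - u *+ n) =
     (u *+ k - a) + (u *+ k' - c) + u *+ n by zmod.
  by do !apply: (C'D) => //; left; apply: coneMn => //; case: u_pos.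
exists C'; split.
- split=> //; first by left; apply: (cone0 hC).
  + move=> x [Cx|Fx] Cx'; last by case: F0; rewrite -(subrr x); apply: FD.
    case: Cx' => [|Fx]; first exact: (cone_pointed hC).
    by case: F0; rewrite -(addNr x); apply: FD => //; left.
  (* Some multiple of [v] lies above [u], and some multiple of [u] above [x]. *)
  + move=> v x Cv v0 /uB [k Ck].
    have [m Cm] : exists m, C' (v *+ m - u).
      case: Cv => [Cv|/Fu //].
      by have [m Cm] := cone_unit hC Cv v0 u_pos.1; exists m; left.
    exists (m * k)%N; have := C'D _ _ (C'Mn _ k Cm) Ck.
    by rewrite mulrnBl mulrnA addrA subrK.
- split=> [x|x y Cx Cy [//|/FP]]; first by left.
  by rewrite raddfB (piC Cx) (piC Cy) subrr => /(_ erefl) [].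
- by move=> g /GC; rewrite inE; right.
- move=> S CS GS x; rewrite inE => -[Cx|[c [s [n [Cc sG _ ->]]]]].
    by apply: CS; rewrite inE.
  rewrite rpredB ?rpredD ?rpredMn //; first by apply: CS; rewrite inE.
    by rewrite big_seq; apply: rpred_sum => g /sG /GS.
  by apply: CS; rewrite inE; case: u_pos.
Qed.
End OneStep.

(** * Adjoining one generator *)

Section POAbGroupTheory.
Variable G : poAbGroupType.

Lemma po_subr_ge0 (x y : G) : (0 <= y - x) = (x <= y).
Proof.
by apply/idP/idP => [/(lepoD2r x)|/(lepoD2r (- x))]; rewrite ?subrK ?add0r ?subrr.
Qed.

Lemma po_addr_ge0 (x y : G) : 0 <= x -> 0 <= y -> 0 <= x + y.
Proof.
by move=> x0 /(lepoD2r x); rewrite add0r addrC; exact: le_trans.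
Qed.
End POAbGroupTheory.

(** * Combinations in which the new generator cancels *)

Section Balanced.
Variables (U : zmodType) (pi : {additive U -> int}).

Lemma sum_zip (p n : seq U) : size p = size n ->
  \sum_(x <- p) x + \sum_(x <- n) x = \sum_(x <- zip p n) (x.1 + x.2).
Proof.
elim: p n => [|x p IH] [|y n] //= => [_|[pn]]; first by rewrite !big_nil addr0.
by rewrite !big_cons addrACA IH.
Qed.

(** Balance forces as many terms from [X] as from [Y]; they are paired off in any order. *)
Lemma balanced_pairs (X Y s : seq U) :
    (forall x, x \in X -> pi x = 1) -> (forall y, y \in Y -> pi y = -1) ->
    {subset s <= X ++ Y} -> pi (\sum_(x <- s) x) = 0 ->
  exists t : seq U, [/\ {subset t <= [seq x + y | x <- X, y <- Y]},
    \sum_(x <- s) x = \sum_(x <- t) x & (size s <= 2 * size t)%N].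
Proof.
move=> piX piY sXY.
have [p [n [pX nY -> ->]]] : exists p n : seq U, [/\ {subset p <= X},
    {subset n <= Y}, \sum_(x <- s) x = \sum_(x <- p) x + \sum_(x <- n) x
    & size s = (size p + size n)%N].
  elim: s sXY => [|z s IH] zs.
    by exists [::], [::]; rewrite big_nil addr0.
  have [x xs|p [n [pX nY sE sz]]] := IH; first by apply: zs; rewrite in_cons xs orbT.
  have := zs z (mem_head _ _); rewrite mem_cat => /orP[zX|zY].
    exists (z :: p), n; rewrite !big_cons sE addrA /= sz; split=> //.
    by move=> x; rewrite in_cons => /orP[/eqP ->|/pX].
  exists p, (z :: n); rewrite !big_cons sE addrCA /= sz addnS; split=> //.
  by move=> x; rewrite in_cons => /orP[/eqP ->|/nY].
have piS (l : seq U) e : (forall x, x \in l -> pi x = e) ->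
    pi (\sum_(x <- l) x) = e *+ size l.
  move=> le; rewrite raddf_sum big_seq (eq_bigr (fun=> e)) => [|x /le //].
  by rewrite -big_seq big_const_seq iter_addr_0 count_predT.
rewrite raddfD (piS _ 1) => [|x /pX /piX //]; rewrite (piS _ (-1)) => [|x /nY /piY //].
move=> pn; have {}pn : size p = size n by lia.
exists [seq x.1 + x.2 | x <- zip p n]; split.
- move=> _ /mapP[[x y] xy ->]; apply/allpairsP; exists (x, y) => /=.
  have [] : x \in unzip1 (zip p n) /\ y \in unzip2 (zip p n).
    by split; apply/mapP; exists (x, y).
  by rewrite unzip1_zip ?unzip2_zip ?pn // => /pX ? /nY ?.
- by rewrite big_map sum_zip.
- by rewrite size_map size_zip pn minnn; lia.
Qed.

(** With [p] terms [a] and [n] terms [b], balance means [2p = 3n], so the terms group into blocks of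
    three [a] and two [b]. *)
Lemma balanced_3a2b (a b : U) (s : seq U) : pi a = - 2 -> pi b = 3 ->
    {subset s <= [:: a; b]} -> pi (\sum_(x <- s) x) = 0 ->
  exists t : seq U, [/\ {subset t <= [:: a *+ 3 + b *+ 2]},
    \sum_(x <- s) x = \sum_(x <- t) x & (size s <= 5 * size t)%N].
Proof.
move=> pa pb sab.
have [p [n [-> ->]]] : exists p n, \sum_(x <- s) x = a *+ p + b *+ n /\
    size s = (p + n)%N.
  elim: s sab => [|z s IH] zs.
    by exists 0%N, 0%N; rewrite big_nil !mulr0n addr0.
  have [x xs|p [n [sE sz]]] := IH; first by apply: zs; rewrite in_cons xs orbT.
  have := zs z (mem_head _ _); rewrite !inE => /orP[/eqP ->|/eqP ->].
    by exists p.+1, n; rewrite big_cons sE addrA -mulrS /= sz addSn.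
  by exists p, n.+1; rewrite big_cons sE addrCA -mulrS /= sz addnS.
rewrite raddfD !raddfMn pa pb => pn.
(* As [p = 3m] and [n = 2m], the number of blocks is their difference. *)
have [m [-> ->]] : exists m, p = (3 * m)%N /\ n = (2 * m)%N by exists (p - n)%N; lia.
exists (nseq m (a *+ 3 + b *+ 2)); split.
- by move=> x; rewrite mem_nseq inE => /andP[].
- by rewrite big_nseq iter_addr_0 mulrnDl -!mulrnA.
- by rewrite size_nseq; lia.
Qed.

End Balanced.

Definition hull (U : zmodType) (C : set U) : {pred U} :=
  fun x => `[< exists c d, [/\ C c, C d & x = c - d] >].

(** * Names and tidy cones *)

Section Completion.
Variable A : poAbGroupType.
Hypothesis hA : simple_group A.

(* [Sub] makes the set of named elements a group; [Between] and [Third] name the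
   generators adjoined to solve an interpolation or a divisibility problem. *)
Inductive name :=
  | Base of A
  | Sub of name & name
  | Between of name & name & name & name
  | Third of name.

Notation U := (A * (name -> int))%type.

Definition gen (q : name) : U := (0, fun q' => `[< q' = q >]%:Z).

Fixpoint value (t : name) : U :=
  match t with
  | Base a => (a, 0)
  | Sub s t => value s - value t
  | t => gen t
  end.

Definition solved (C : set U) (q : name) : Prop :=
  match q with
  | Between x0 x1 y0 y1 =>
    [/\ C (gen q - value x0), C (gen q - value x1),
        C (value y0 - gen q) & C (value y1 - gen q)]
  | Third x => C (gen q *+ 3 - value x) /\ C (value x - gen q *+ 2)
  | _ => True
  end.

Definition base_cone : set U := [set c | 0 <= c.1 /\ c.2 = 0].

(** [tidy_named] lets every problem in the difference group be posed as a name; [tidy_solved] keeps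
    the coordinate of an unsolved problem free. *)
Record tidy (C : set U) : Prop := Tidy {
  tidy_simple : simple_cone C;
  tidy_ext : order_extension base_cone C;
  tidy_cofinal : forall x, C x -> exists2 c, base_cone c & C (c - x);
  tidy_named : C `<=` range value;
  tidy_solved : forall q, (forall c, C c -> c.2 q = 0) \/ solved C q
}.

Definition coord (q : name) (c : U) : int := c.2 q.

Arguments coord : simpl never.

Lemma coord_is_additive q : zmod_morphism (coord q).
Proof. by move=> x y. Qed.

HB.instance Definition _ q :=
  GRing.isZmodMorphism.Build U int (coord q) (coord_is_additive q).

Lemma order_extension_trans (V : zmodType) (C1 C2 C3 : set V) :
  order_extension C1 C2 -> order_extension C2 C3 -> order_extension C1 C3.
Proof.
move=> [C12 e12] [C23 e23]; split; first exact: subset_trans C12 C23.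
by move=> x y Cx Cy /e23 C2xy; apply: e12 => //; apply: C2xy; apply: C12.
Qed.

Lemma solved_sub (C C' : set U) q : C `<=` C' -> solved C q -> solved C' q.
Proof.
move=> CC'; case: q => //= [x0 x1 y0 y1 []|x []].
  by move=> /CC' ? /CC' ? /CC' ? /CC' ?.
by move=> /CC' ? /CC' ?.
Qed.

Lemma tidy_base : tidy base_cone.
Proof.
have [dirA unitA] := hA.
split=> //.
- split=> /=.
  + by split.
  + by move=> x y [x1 x2] [y1 y2]; split=> /=; [exact: po_addr_ge0|rewrite x2 y2 addr0].
  + move=> [x x'] [/= x1 ->] [/= x2 _]; congr (_, _); apply/eqP.
    by rewrite eq_le x1 andbT -po_subr_ge0 sub0r.
  + move=> [u u'] [x x'] [/= u1 ->] u0 [/= x1 ->].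
    have [|_ /(_ x) [n [_ xn]]] := unitA u u1.
      by move=> uu; apply: u0; rewrite uu.
    have unE : ((u, 0) : U) *+ n = (u *+ n, 0) by rewrite pairMnE /= mul0rn.
    by exists n; rewrite unE; split=> /=; rewrite ?subr0 ?po_subr_ge0.
- by split.
- by move=> x Cx; exists x => //; rewrite subrr; split.
- by move=> [c c'] [/= _ ->]; exists (Base c).
- by move=> q; left=> c [_ ->].
Qed.

Definition named : {pred U} := fun x => `[< range value x >].

(** A one-step extension stays inside every subgroup containing [C] and [G]; applied to [named] and
    [vanishing], this passes on [tidy_named] and [tidy_solved]. *)
Lemma named_zmod_closed : zmod_closed named.
Proof.
have nB : {in named &, forall x y, x - y \in named}.
  by move=> _ _ /asboolP[s _ <-] /asboolP[t _ <-]; apply/asboolP; exists (Sub s t).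
split=> //; rewrite -(subrr (value (Base 0))); apply: nB;
  by apply/asboolP; exists (Base 0).
Qed.

HB.instance Definition _ :=
  GRing.isZmodClosed.Build U named named_zmod_closed.

Definition vanishing (q : name) : {pred U} := fun x => x.2 q == 0.

Lemma vanishing_zmod_closed q : zmod_closed (vanishing q).
Proof.
by split=> [|x y /eqP xq /eqP yq]; apply/eqP => //=; rewrite -[LHS]/(x.2 q - y.2 q) xq yq.
Qed.

HB.instance Definition _ q :=
  GRing.isZmodClosed.Build U (vanishing q) (vanishing_zmod_closed q).

Lemma vanishingP q x : reflect (coord q x = 0) (x \in vanishing q).
Proof. exact: eqP. Qed.

Lemma hull_sub (C : set U) (S : zmodClosed U) :
  {subset C <= S} -> {subset hull C <= S}.
Proof.
by move=> CS _ /asboolP[c [d [Cc Cd ->]]]; rewrite rpredB // CS // inE.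
Qed.

Lemma gen_coord q : coord q (gen q) = 1.
Proof. by rewrite /coord /= asboolT. Qed.

Lemma gen_vanishing q q' : q' <> q -> gen q \in vanishing q'.
Proof. by move=> qq; rewrite unfold_in /= asboolF. Qed.

Lemma tidy_extend (C : set U) (q : name) (G D : seq U) (r : nat) (u : U) :
    tidy C -> {subset C <= vanishing q} -> pos C u -> (0 < r)%N ->
    (forall d, d \in D -> pos C d) ->
    (forall s : seq U, {subset s <= G} -> coord q (\sum_(g <- s) g) = 0 ->
      exists t : seq U, [/\ {subset t <= D}, \sum_(g <- s) g = \sum_(d <- t) d
        & (size s <= r * size t)%N]) ->
    (forall g, g \in G -> exists s : seq U,
      [/\ {subset s <= G}, (0 < size s)%N & C (g + \sum_(h <- s) h)]) ->
    (forall S : zmodClosed U, {subset C <= S} -> gen q \in S -> {subset G <= S}) ->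
    (forall C' : set U, {subset G <= C'} -> solved C' q) -> value q = gen q ->
  exists C' : set U, [/\ tidy C', order_extension C C' & solved C' q].
Proof.
move=> tC Cq u_pos r0 D_pos G_bal G_bnd GS G_solves qE.
have [C' [sC' eC' GC' C'S]] : exists C' : set U,
    [/\ simple_cone C', order_extension C C', {subset G <= C'} &
      forall S : zmodClosed U, {subset C <= S} -> {subset G <= S} ->
      {subset C' <= S}].
  apply: (one_step_extension (pi := coord q)) G_bal G_bnd => //.
  - exact: tidy_simple tC.
  - by move=> c Cc; apply/vanishingP/Cq; rewrite inE.
  - exact: u_pos.
have Cnamed : {subset C <= named}.
  by move=> c; rewrite inE => Cc; apply/asboolP; exact: (tidy_named tC).
have qnamed : gen q \in named by apply/asboolP; exists q.
exists C'; split=> //; last exact: G_solves.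
split=> //.
- exact: order_extension_trans (tidy_ext tC) eC'.
(* [x] lies below a multiple of [u], which lies below an element of the base cone. *)
- move=> x C'x; have C'u := eC'.1 _ u_pos.1.
  have [n C'n] := cone_unit sC' C'u u_pos.2 C'x.
  have [c c0 Cc] := tidy_cofinal tC (coneMn (tidy_simple tC) n u_pos.1).
  by exists c => //; have := coneD sC' (eC'.1 _ Cc) C'n; rewrite addrA subrK.
- move=> x C'x; have : x \in named by apply: C'S; rewrite ?inE //; exact: GS.
  by move/asboolP.
- move=> q'; have [->|qq'] := pselect (q' = q).
    by right; apply: G_solves.
  case: (tidy_solved tC q') => [Cq'|]; last first.
    by right; apply: (solved_sub eC'.1).
  (* A coordinate other than [q] that vanishes on [C] also vanishes on [gen q], hence on all of
     [C']. *)
  have {}Cq' : {subset C <= vanishing q'}.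
    by move=> c; rewrite inE => /Cq' cq; apply/vanishingP.
  left=> c C'c; have : c \in vanishing q'.
    by apply: C'S; rewrite ?inE //; apply: GS => //; apply: gen_vanishing.
  by move/vanishingP.
Qed.

Lemma tidy_between (C : set U) x0 x1 y0 y1 :
    tidy C -> {subset [:: value x0; value x1; value y0; value y1] <= hull C} ->
    pos C (value y0 - value x0) -> pos C (value y0 - value x1) ->
    pos C (value y1 - value x0) -> pos C (value y1 - value x1) ->
  exists C' : set U, [/\ tidy C', order_extension C C' &
    solved C' (Between x0 x1 y0 y1)].
Proof.
set q := Between _ _ _ _ => tC Vhull p00 p01 p10 p11.
(* If the problem is already solved, [C] itself serves. *)
case: (tidy_solved tC q) => [Cq|]; last by exists C; split=> //; split.
have {}Cq : {subset C <= vanishing q}.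
  by move=> c; rewrite inE => /Cq cq; apply/vanishingP.
(* The bounds are differences of elements of [C], so they do not involve the new generator. *)
have Vq v : v \in [:: value x0; value x1; value y0; value y1] -> coord q v = 0.
  by move=> /Vhull vC; apply/vanishingP/(hull_sub Cq).
have vx0 : coord q (value x0) = 0 by apply: Vq; rewrite !inE eqxx.
have vx1 : coord q (value x1) = 0 by apply: Vq; rewrite !inE eqxx ?orbT.
have vy0 : coord q (value y0) = 0 by apply: Vq; rewrite !inE eqxx ?orbT.
have vy1 : coord q (value y1) = 0 by apply: Vq; rewrite !inE eqxx ?orbT.
pose X := [:: gen q - value x0; gen q - value x1].
pose Y := [:: value y0 - gen q; value y1 - gen q].
have XYpos x y : x \in X -> y \in Y -> pos C (x + y).
  have e a b : gen q - a + (b - gen q) = b - a by zmod.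
  by rewrite !inE => /orP[]/eqP -> /orP[]/eqP ->; rewrite e.
apply: (@tidy_extend C q (X ++ Y) [seq x + y | x <- X, y <- Y] 2 _ tC Cq p00) => //.
- by move=> _ /allpairsP[[x y] [/= xX yY ->]]; exact: XYpos.
- move=> s; apply: balanced_pairs => x; rewrite !inE => /orP[]/eqP ->.
  + by rewrite raddfB /= gen_coord vx0.
  + by rewrite raddfB /= gen_coord vx1.
  + by rewrite raddfB /= gen_coord vy0.
  + by rewrite raddfB /= gen_coord vy1.
- have x0X : gen q - value x0 \in X by rewrite mem_head.
  have y0Y : value y0 - gen q \in Y by rewrite mem_head.
  (* One element from the opposite side cancels [gen q] and leaves an old positive element, which
     bounds [g]. *)
  move=> g; rewrite mem_cat => /orP[gX|gY].
    exists [:: value y0 - gen q]; split=> //; last first.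
      by rewrite big_seq1; apply: (XYpos _ _ _ _).1.
    by move=> h; rewrite mem_seq1 mem_cat => /eqP ->; rewrite y0Y orbT.
  exists [:: gen q - value x0]; split=> //; last first.
    by rewrite big_seq1 addrC; apply: (XYpos _ _ _ _).1.
  by move=> h; rewrite mem_seq1 mem_cat => /eqP ->; rewrite x0X.
- move=> S CS qS.
  have VS v : v \in [:: value x0; value x1; value y0; value y1] -> v \in S.
    by move=> /Vhull; exact: hull_sub.
  move=> g; rewrite !inE => /or4P[]/eqP ->; rewrite rpredB // VS //;
    by rewrite !inE eqxx ?orbT.
- by move=> C' GC'; split; apply/set_mem/GC'; rewrite !inE eqxx ?orbT.
Qed.

Lemma tidy_third (C : set U) x :
    tidy C -> pos C (value x) ->
  exists C' : set U, [/\ tidy C', order_extension C C' & solved C' (Third x)].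
Proof.
set q := Third _ => tC xpos.
case: (tidy_solved tC q) => [Cq|]; last by exists C; split=> //; split.
have {}Cq : {subset C <= vanishing q}.
  by move=> c; rewrite inE => /Cq cq; apply/vanishingP.
have vx : coord q (value x) = 0 by apply/vanishingP/Cq; rewrite inE; exact: xpos.1.
pose a := value x - gen q *+ 2.
pose b := gen q *+ 3 - value x.
have abx : a *+ 3 + b *+ 2 = value x by rewrite /a /b; zmod.
apply: (@tidy_extend C q [:: a; b] [:: value x] 5 _ tC Cq xpos) => //.
- by move=> d; rewrite inE => /eqP ->.
- move=> s; rewrite -{1}abx; apply: balanced_3a2b.
    by rewrite raddfB raddfMn /= gen_coord vx.
  by rewrite raddfB raddfMn /= gen_coord vx.
- have sub l : all (mem [:: a; b]) l -> {subset l <= [:: a; b]} by move/allP.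
  (* Complete [g] to [a *+ 3 + b *+ 2], which is [value x]. *)
  move=> g; rewrite !inE => /orP[]/eqP ->.
    exists [:: a; a; b; b]; split=> //; first by apply: sub; rewrite /= !inE !eqxx !orbT.
    have -> : a + \sum_(h <- [:: a; a; b; b]) h = value x.
      by rewrite !big_cons big_nil -abx; zmod.
    exact: xpos.1.
  exists [:: a; a; a; b]; split=> //; first by apply: sub; rewrite /= !inE !eqxx !orbT.
  have -> : b + \sum_(h <- [:: a; a; a; b]) h = value x.
    by rewrite !big_cons big_nil -abx; zmod.
  exact: xpos.1.
- move=> S CS qS g; have xS : value x \in S by apply: CS; rewrite inE; exact: xpos.1.
  by rewrite !inE => /orP[]/eqP ->; rewrite rpredB // rpredMn.
- by move=> C' GC'; split; apply/set_mem/GC'; rewrite !inE eqxx ?orbT.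
Qed.

End Completion.

(** * The maximal cone and its group *)

Lemma maximal_tidy (A : poAbGroupType) : simple_group A ->
  exists2 C : set (A * (name A -> int)), tidy C &
    forall C', tidy C' -> order_extension C C' -> C' = C.
Proof.
move=> hA.
pose T := {C : set (A * (name A -> int)) | tidy C}.
(* Plain inclusion would allow new relations between old elements. *)
pose R (s t : T) := `[< order_extension (sval s) (sval t) >].
have [|r s t /asboolP rs /asboolP st|s t /asboolP[st _] /asboolP[ts _]|F totF|] :=
    @Zorn T R; last move=> [C tC] Cmax.
- by move=> t; apply/asboolP; split.
- exact/asboolP/(order_extension_trans rs).
- by case: s t st ts => [s s'] [t t'] /= st ts; apply/eq_exist/seteqP.
(* The empty chain is bounded by the base cone, any other chain by its union. *)
- have [[C0 FC0]|F0] := pselect (exists C, F C); last first.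
    by exists (exist _ _ (tidy_base hA)) => s Fs; case: F0; exists s.
  pose C := \bigcup_(s in F) sval s.
  have FC s : F s -> sval s `<=` C by move=> Fs x sx; exists s.
  have join s t : F s -> F t -> exists2 r, F r &
      order_extension (sval s) (sval r) /\ order_extension (sval t) (sval r).
    move=> Fs Ft; have [/asboolP st|/asboolP ts] := totF s t Fs Ft.
      by exists t => //; split=> //; split.
    by exists s => //; split=> //; split.
  have C2 x y : C x -> C y -> exists2 r, F r & sval r x /\ sval r y.
    move=> [s Fs sx] [t Ft ty]; have [r Fr [[sr _] [tr _]]] := join s t Fs Ft.
    by exists r => //; split; [exact: sr|exact: tr].
  have sC s : F s -> order_extension (sval s) C.
    move=> Fs; split=> [|x y sx sy [t Ft txy]]; first exact: FC.
    have [r Fr [[sr esr] [tr _]]] := join s t Fs Ft.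
    by apply: esr => //; exact: tr.
  suff tC : tidy C by exists (exist _ C tC) => s Fs; apply/asboolP/sC.
  split.
  + split.
    * by exists C0 => //; exact: (cone0 (tidy_simple (svalP C0))).
    * move=> x y Cx Cy; have [r Fr [rx ry]] := C2 x y Cx Cy.
      by exists r => //; exact: (coneD (tidy_simple (svalP r))).
    * move=> x Cx Cy; have [r Fr [rx ry]] := C2 _ _ Cx Cy.
      exact: (cone_pointed (tidy_simple (svalP r))).
    * move=> u x Cu u0 Cx; have [r Fr [ru rx]] := C2 _ _ Cu Cx.
      have [n rn] := cone_unit (tidy_simple (svalP r)) ru u0 rx.
      by exists n, r.
  + exact: order_extension_trans (tidy_ext (svalP C0)) (sC _ FC0).
  + move=> x [s Fs sx]; have [c c0 sc] := tidy_cofinal (svalP s) sx.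
    by exists c => //; exists s.
  + by move=> x [s Fs sx]; exact: (tidy_named (svalP s)).
  (* A problem solved in one member is solved in the union; if it is solved in none, its coordinate
     vanishes on every member. *)
  + move=> q; have [[s Fs sq]|nq] := pselect (exists2 s, F s & solved (sval s) q).
      by right; exact: solved_sub (FC _ Fs) sq.
    left=> c [s Fs sc]; case: (tidy_solved (svalP s) q) => [/(_ c sc) //|sq].
    by case: nq; exists s.
exists C => // C' tC' eC'.
exact: (congr1 sval (Cmax (exist _ C' tC') (introT (asboolP _) eC'))).
Qed.

(** Carrying the proof with the set lets the group and order structures on [hull_group C] be
    inferred. *)
Record bundled_cone (U : zmodType) := BundledCone {
  cone_set :> set U;
  cone_setP : simple_cone cone_set
}.

(** * The simple ordered group of a cone *)

Section HullGroup.
Variables (U : zmodType) (C : bundled_cone U).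

Lemma hull_zmod_closed : zmod_closed (hull C).
Proof.
have hC := cone_setP C.
split=> [|_ _ /asboolP[c [d [Cc Cd ->]]] /asboolP[c' [d' [Cc' Cd' ->]]]]; apply/asboolP.
  by exists 0, 0; rewrite subrr; split=> //; exact: cone0 hC.
by exists (c + d'), (d + c'); split; try exact: (coneD hC); zmod.
Qed.

HB.instance Definition _ := GRing.isZmodClosed.Build U (hull C) hull_zmod_closed.

Record hull_group := HullGroup { hull_val : U; hull_valP : hull_val \in hull C }.

HB.instance Definition _ := [isSub for hull_val].
HB.instance Definition _ := [Choice of hull_group by <:].
HB.instance Definition _ := [SubChoice_isSubZmodule of hull_group by <:].

Definition hull_le (x y : hull_group) := `[< cone_set C (val y - val x) >].

Lemma hull_le_refl : reflexive hull_le.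
Proof. by move=> x; apply/asboolP; rewrite subrr; exact: (cone0 (cone_setP C)). Qed.

Lemma hull_le_anti : antisymmetric hull_le.
Proof.
move=> x y /andP[/asboolP xy /asboolP yx]; apply/val_inj/esym/subr0_eq.
by apply: (cone_pointed (cone_setP C)) => //; rewrite opprB.
Qed.

Lemma hull_le_trans : transitive hull_le.
Proof.
move=> y x z /asboolP xy /asboolP yz; apply/asboolP.
by have := coneD (cone_setP C) yz xy; rewrite addrA subrK.
Qed.

HB.instance Definition _ := Order.isPOrder.Build ring_display hull_group
  (fun _ _ => erefl) hull_le_refl hull_le_anti hull_le_trans.

Lemma hull_leD (z x y : hull_group) : x <= y -> x + z <= y + z.
Proof. by move=> /asboolP xy; apply/asboolP; rewrite !raddfD /= addrACA subrr addr0. Qed.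

HB.instance Definition _ := isTranslationInvariant.Build hull_group hull_leD.

Lemma hull_leE (x y : hull_group) : (x <= y) <-> cone_set C (val y - val x).
Proof. by split=> [/asboolP|?]; [|apply/asboolP]. Qed.

Lemma hull_ge0 (x : hull_group) : (0 <= x) <-> cone_set C (val x).
Proof. by rewrite hull_leE -raddfB subr0. Qed.

Lemma cone_hull x : cone_set C x -> x \in hull C.
Proof.
move=> Cx; apply/asboolP; exists x, 0; rewrite subr0; split=> //.
exact: (cone0 (cone_setP C)).
Qed.

Lemma hull_directed : directed_group hull_group.
Proof.
case=> x hx; have /asboolP[c [d [Cc Cd xE]]] := hx.
exists (HullGroup (cone_hull Cc)), (HullGroup (cone_hull Cd)).
by split; [exact/hull_ge0|exact/hull_ge0|exact: val_inj].
Qed.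

Lemma hull_simple : simple_group hull_group.
Proof.
split=> [|u /hull_ge0 Cu u0]; first exact: hull_directed.
split=> [|x]; first exact/hull_ge0.
have [y [z [/hull_ge0 Cy /hull_ge0 Cz ->]]] := hull_directed x.
have u0' : val u <> 0 by move=> u0'; apply/u0/val_inj; rewrite u0' raddf0.
have [n Cn] := cone_unit (cone_setP C) Cu u0' Cy.
(* [y - z] lies below [y], hence below [u *+ n]; the successor makes the multiplier positive. *)
exists n.+1; split=> //; apply/hull_leE.
have -> : val (u *+ n.+1) - val (y - z) = val u + (val u *+ n - val y) + val z.
  by rewrite raddfMn raddfB mulrS /=; zmod.
by apply: (coneD (cone_setP C)) => //; exact: (coneD (cone_setP C)).
Qed.
End HullGroup.

(** * Properties of the group of a maximal cone *)

Section MaximalCone.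
Variables (A : poAbGroupType) (C : set (A * (name A -> int))).
Hypotheses (hA : simple_group A) (tC : tidy C).
Hypothesis maxC : forall C', tidy C' -> order_extension C C' -> C' = C.

Let K := BundledCone (tidy_simple tC).

Lemma hull_named v : v \in hull C -> exists t, v = value t.
Proof.
move=> hv; have : v \in @named A.
  apply: hull_sub hv => c; rewrite inE => Cc.
  by apply/asboolP; exact: (tidy_named tC).
by move/asboolP => [t _ <-]; exists t.
Qed.

(** By maximality, the tidy extension that solves the problem is [C] itself. *)
Lemma between_max x0 x1 y0 y1 :
    {subset [:: value x0; value x1; value y0; value y1] <= hull C} ->
    pos C (value y0 - value x0) -> pos C (value y0 - value x1) ->
    pos C (value y1 - value x0) -> pos C (value y1 - value x1) ->
  solved C (Between x0 x1 y0 y1).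
Proof.
move=> V p00 p01 p10 p11.
by have [C' [tC' /(maxC tC') ->]] := tidy_between tC V p00 p01 p10 p11.
Qed.

Lemma third_max x : pos C (value x) -> solved C (Third x).
Proof. by move=> p; have [C' [tC' /(maxC tC') ->]] := tidy_third tC p. Qed.

Lemma maximal_interpolation : interpolation (hull_group K).
Proof.
move=> x0 x1 y0 y1 le00 le01 le10 le11.
(* If some [x_i] equals some [y_j], it interpolates; otherwise all four differences are strictly
   positive, as [between_max] requires. *)
have [e00|n00] := eqVneq x0 y0; first by exists x0; split=> //; rewrite e00.
have [e01|n01] := eqVneq x0 y1; first by exists x0; split=> //; rewrite e01.
have [e10|n10] := eqVneq x1 y0; first by exists x1; split=> //; rewrite e10.
have [e11|n11] := eqVneq x1 y1; first by exists x1; split=> //; rewrite e11.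
have ltP (x y : hull_group K) : x <= y -> x != y -> pos C (val y - val x).
  move=> /hull_leE xy /eqP nxy; split=> // /subr0_eq yx.
  by apply: nxy; apply: val_inj.
have [tx0 ex0] := hull_named (hull_valP x0).
have [tx1 ex1] := hull_named (hull_valP x1).
have [ty0 ey0] := hull_named (hull_valP y0).
have [ty1 ey1] := hull_named (hull_valP y1).
have [||||| Cx0 Cx1 Cy0 Cy1] := @between_max tx0 tx1 ty0 ty1;
  rewrite -?ex0 -?ex1 -?ey0 -?ey1; try exact: ltP.
  by move=> v; rewrite !(in_cons, in_nil) orbF => /or4P[]/eqP ->; exact: hull_valP.
set g := gen _ in Cx0 Cx1 Cy0 Cy1.
(* [g] is the sum of the positive element [g - value tx0] and of [x0]. *)
have gh : g \in hull K.
  rewrite -(subrK (value tx0) g) rpredD //; first exact: cone_hull.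
  by rewrite -ex0 hull_valP.
by exists (HullGroup gh); split; apply/hull_leE;
  rewrite ?[val x0]ex0 ?[val x1]ex1 ?[val y0]ey0 ?[val y1]ey1.
Qed.

Lemma maximal_quasi_divisible : quasi_divisible (@positive_cone (hull_group K)).
Proof.
move=> x /hull_ge0 Cx.
(* [third_max] asks for a nonzero element, so 0 is split separately. *)
have [->|/eqP x0] := eqVneq x 0.
  by exists 0, 0; split; rewrite ?mul0rn ?addr0 //; exact: lexx.
have [tx ex] := hull_named (hull_valP x).
have [|Cu Cv] := @third_max tx.
  by rewrite -ex; split=> // x0'; apply: x0; apply: val_inj.
set g := gen _ in Cu Cv.
have uh := @cone_hull _ K _ Cu; have vh := @cone_hull _ K _ Cv.
exists (HullGroup uh), (HullGroup vh); split; try exact/hull_ge0.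
apply: val_inj; rewrite raddfD !raddfMn /= [RHS]ex.
set v := value tx; zmod.
Qed.

(** Directedness of [A] brings in all of [A], not only its positive cone. *)
Lemma base_hull a : ((a, 0) : A * (name A -> int)) \in hull K.
Proof.
have [y [z [y0 z0 ->]]] := hA.1 a.
apply/asboolP; exists (y, 0), (z, 0); split; try exact: (tidy_ext tC).1.
by congr (_, _); rewrite subr0.
Qed.

Definition base_embedding (a : A) : hull_group K := HullGroup (base_hull a).

Lemma base_embedding_is_additive : zmod_morphism base_embedding.
Proof. by move=> x y; apply: val_inj; rewrite raddfB /=; congr (_, _); rewrite subr0. Qed.

HB.instance Definition _ := GRing.isZmodMorphism.Build A (hull_group K)
  base_embedding base_embedding_is_additive.

Lemma base_embedding_po : po_embedding base_embedding.
Proof.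
split=> [x y /(congr1 val) [] //|x].
rewrite hull_ge0 /=; split=> [x0|Cx]; first exact: (tidy_ext tC).1.
(* [tidy_ext] speaks of differences of base cone elements, so [x] is first written as one. *)
have [y [z [y0 z0 xE]]] := hA.1 x.
have e : (x, 0) = ((y, 0) - (z, 0) : A * (name A -> int)).
  by rewrite xE; congr (_, _); rewrite subr0.
rewrite e in Cx.
have [] := (tidy_ext tC).2 (y, 0) (z, 0) (conj y0 erefl) (conj z0 erefl) Cx.
by rewrite /= xE.
Qed.

Lemma base_embedding_cofinal : cofinal_map base_embedding.
Proof.
move=> b; have [c [d [/hull_ge0 Cc /hull_ge0 Cd ->]]] := hull_directed b.
have [[a h] [/= _ ->] Ca] := tidy_cofinal tC Cc.
exists a; apply/hull_leE.
have -> : val (base_embedding a) - val (c - d) = (a, 0) - val c + val d.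
  by rewrite (raddfB val) /=; zmod.
exact: (coneD (tidy_simple tC)).
Qed.

Lemma name_fun_torsion_free (h h' : name A -> int) p :
  (0 < p)%N -> h *+ p = h' *+ p -> h = h'.
Proof.
move=> p0 hh; apply/funext => q; have := congr1 (fun k => k q) hh.
by rewrite !natmulfctE => /(Num.Theory.pmulrnI p0).
Qed.

(** The image of [A] consists of the elements with zero component in [name -> int]. If [p] times
    [b - c] has that component zero, so does [b - c], which is then the image of its component in
    [A]. *)
Lemma base_coker_torsion_free : torsion_free (coker base_embedding).
Proof.
move=> p p0 x y; rewrite -[x]reprK -[y]reprK -!raddfMn => /eqP.
rewrite -Quotient.idealrBE => e; apply/eqP; rewrite -Quotient.idealrBE.
move: (repr x) (repr y) e => b c /asboolP[a _ e].
apply/asboolP; exists (val (b - c)).1 => //; apply: val_inj.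
rewrite [RHS]surjective_pairing; congr (_, _).
apply: (@name_fun_torsion_free _ _ p p0).
rewrite -mulrnBl in e; have := congr1 (fun z : hull_group K => (val z).2) e.
by rewrite raddfMn pairMnE /= => <-; rewrite mul0rn.
Qed.

Lemma hull_torsion_free_wrt (P : set nat) : mul_subsemigroup P ->
  torsion_free_wrt P A -> torsion_free_wrt P (hull_group K).
Proof.
move=> [P0 _] tfA p Pp x y /(congr1 val); rewrite !raddfMn /= !pairMnE => -[e1 e2].
apply: val_inj; rewrite [LHS]surjective_pairing [RHS]surjective_pairing.
congr (_, _); first exact: tfA e1.
exact: name_fun_torsion_free (P0 _ Pp) e2.
Qed.

End MaximalCone.

Unset Implicit Arguments.

Theorem corollary3p12 (P : set nat) (hP : mul_subsemigroup P)
    (hP1 : ~ (P `<=` [set 1%N]))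
    (A : poAbGroupType) (hA : simple_group A) (htA : torsion_free_wrt P A) :
  exists (B : poAbGroupType) (f : {additive A -> B}),
    [/\ po_embedding f, cofinal_map f & torsion_free (coker f)] /\
    [/\ simple_group B, torsion_free_wrt P B, riesz_group B
      & quasi_divisible (@positive_cone B)].
Proof.
have [C tC maxC] := maximal_tidy hA.
exists (hull_group (BundledCone (tidy_simple tC))), (base_embedding hA tC).
split; split.
- exact: base_embedding_po.
- exact: base_embedding_cofinal.
- exact: base_coker_torsion_free.
- exact: hull_simple.
- exact: hull_torsion_free_wrt hP htA.
- by split; [exact: hull_directed|exact: maximal_interpolation maxC].
- exact: maximal_quasi_divisible maxC.
Qed.
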